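(* Let $\Omega_c$ be a commutative semigroup and let $(A,\prec_{\omega_1,\omega_2},\succ_{\omega_1,\omega_2},\Omega_c)$ be an $\Omega_c$-relative pre-anti-flexible algebra. For $x,y\in A$ and $\alpha,\beta\in\Omega_c$ put $$x\circledast_{\alpha,\beta}y = x\prec_{\alpha,\beta}y + x\succ_{\alpha,\beta}y,\quad x\circledcirc_{\alpha,\beta}y = x\circledast_{\alpha,\beta}y + y\circledast_{\beta,\alpha}x,\quad [x,y]_{\alpha,\beta} = x\circledast_{\alpha,\beta}y - y\circledast_{\beta,\alpha}x .$$ Then for all $x,y,z\in A$ and $\alpha,\beta,\gamma\in\Omega_c$, $$(x\circledcirc_{\alpha,\beta}y)\circledcirc_{\alpha\beta,\gamma}z - x\circledcirc_{\alpha,\beta\gamma}(y\circledcirc_{\beta,\gamma}z) = [y,[x,z]_{\alpha,\gamma}]_{\beta,\alpha\gamma}.$$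
   Context: Standing conventions: $\Omega_c$ is a commutative associative semigroup; $A$ is a finite-dimensional vector space over a field of characteristic zero; all operations on $A$ are bilinear. An $\Omega_c$-relative pre-anti-flexible algebra is a vector space $A$ with bilinear operations $\prec_{\alpha,\beta},\succ_{\alpha,\beta}:A\times A\to A$ for each $(\alpha,\beta)\in\Omega_c^2$ such that for all $x,y,z\in A$ and $\alpha,\beta,\gamma\in\Omega_c$: $$(x\succ_{\alpha,\beta}y)\prec_{\alpha\beta,\gamma}z - x\succ_{\alpha,\beta\gamma}(y\prec_{\beta,\gamma}z) = (z\succ_{\gamma,\beta}y)\prec_{\gamma\beta,\alpha}x - z\succ_{\gamma,\beta\alpha}(y\prec_{\beta,\alpha}x),$$ $$(x\prec_{\alpha,\beta}y + x\succ_{\alpha,\beta}y)\succ_{\alpha\beta,\gamma}z - x\succ_{\alpha,\beta\gamma}(y\succ_{\beta,\gamma}z) = (z\prec_{\gamma,\beta}y)\prec_{\gamma\beta,\alpha}x - z\prec_{\gamma,\beta\alpha}(y\prec_{\beta,\alpha}x + y\succ_{\beta,\alpha}x).$$ *)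

(* Defs.v *)
From HB Require Import structures.
From mathcomp Require Import all_boot all_order all_algebra.
Set Implicit Arguments.
Unset Strict Implicit.
Unset Printing Implicit Defensive.
Import GRing.Theory.
Local Open Scope ring_scope.

(* Commutativity of Omega is not built in: it is a separate hypothesis where
   needed, so the order of the factors in each index below is significant. *)
Record relPreAntiFlexible (F : fieldType) (Omega : semigroupType)
    (A : vectType F) := RelPreAntiFlexible {
  prec : Omega -> Omega -> {bilinear A -> A -> A};
  succ : Omega -> Omega -> {bilinear A -> A -> A};
  prec_succ_flex : forall (x y z : A) (a b c : Omega),
    prec (a * b)%g c (succ a b x y) z - succ a (b * c)%g x (prec b c y z) =
    prec (c * b)%g a (succ c b z y) x - succ c (b * a)%g z (prec b a y x);
  succ_prec_flex : forall (x y z : A) (a b c : Omega),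
    succ (a * b)%g c (prec a b x y + succ a b x y) z
      - succ a (b * c)%g x (succ b c y z) =
    prec (c * b)%g a (prec c b z y) x
      - prec c (b * a)%g z (prec b a y x + succ b a y x)
}.

Section DerivedOperations.

Variables (F : fieldType) (Omega : semigroupType) (A : vectType F).
Variable P : relPreAntiFlexible Omega A.

Definition ast (a b : Omega) (x y : A) : A := prec P a b x y + succ P a b x y.

Definition circ (a b : Omega) (x y : A) : A := ast a b x y + ast b a y x.

Definition bracket (a b : Omega) (x y : A) : A := ast a b x y - ast b a y x.

End DerivedOperations.

(* Main.v *)
(* Write xy for ast x y. The associator (xy)z - x(yz) is the sum of the left-hand
   sides of the two axioms and of the right-hand side of the second one with
   x and z exchanged, so it is invariant under exchanging x and z; equivalently,
   J(x,y,z) := (xy)z + z(yx) satisfies J(x,y,z) = J(z,y,x). Expanding,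
   (x o y) o z = J(x,y,z) + J(y,x,z), x o (y o z) = J(z,y,x) + J(y,z,x) and
   [y,[x,z]] = J(z,x,y) - J(x,z,y), so that the identity follows. *)
Require Import Defs.
From HB Require Import structures.
From mathcomp Require Import all_boot all_order all_algebra.
Set Implicit Arguments.
Unset Strict Implicit.
Unset Printing Implicit Defensive.
Import GRing.Theory.
Local Open Scope ring_scope.

Section AntiFlexibleSum.

Variables (F : fieldType) (Omega : semigroupType) (A : vectType F).
Variable P : relPreAntiFlexible Omega A.
Implicit Types (x y z : A) (a b c : Omega).

Lemma astDl a b x y z : ast P a b (x + y) z = ast P a b x z + ast P a b y z.
Proof. by rewrite /ast !linearDl addrACA. Qed.

Lemma astDr a b x y z : ast P a b x (y + z) = ast P a b x y + ast P a b x z.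
Proof. by rewrite /ast !linearD addrACA. Qed.

Lemma astBl a b x y z : ast P a b (x - y) z = ast P a b x z - ast P a b y z.
Proof. by rewrite /ast !linearBl addrACA opprD. Qed.

Lemma astBr a b x y z : ast P a b x (y - z) = ast P a b x y - ast P a b x z.
Proof. by rewrite /ast !linearB addrACA opprD. Qed.

Definition ast_assoc a b c x y z : A :=
  ast P (a * b)%g c (ast P a b x y) z - ast P a (b * c)%g x (ast P b c y z).

Lemma ast_assocE a b c x y z : ast_assoc a b c x y z =
  (prec P (a * b)%g c (succ P a b x y) z
     - succ P a (b * c)%g x (prec P b c y z)) +
  ((succ P (a * b)%g c (prec P a b x y + succ P a b x y) z
     - succ P a (b * c)%g x (succ P b c y z)) +
   (prec P (a * b)%g c (prec P a b x y) z
     - prec P a (b * c)%g x (prec P b c y z + succ P b c y z))).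
Proof.
rewrite /ast_assoc /ast.
(* Only these two sums are expanded; the other two occur as such in [succ_prec_flex]. *)
rewrite [prec P (a * b)%g c (_ + _) z]linearDl.
rewrite [succ P a (b * c)%g x (_ + _)]linearD.
by rewrite !opprD [RHS](AC (2*(2*2)) ((5*1*3)*(6*(2*4)))).
Qed.

Lemma ast_antiflexible a b c x y z :
  ast_assoc a b c x y z = ast_assoc c b a z y x.
Proof.
(* [prec_succ_flex] is symmetric in x and z, hence used once, on one side; [succ_prec_flex] acts on
   both sides and leaves the same two terms in opposite order. *)
rewrite !ast_assocE prec_succ_flex !succ_prec_flex.
by congr (_ + _); exact: addrC.
Qed.

Definition jordan_sum a b c x y z : A :=
  ast P (a * b)%g c (ast P a b x y) z + ast P c (b * a)%g z (ast P b a y x).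

Lemma jordan_sumC a b c x y z :
  jordan_sum a b c x y z = jordan_sum c b a z y x.
Proof.
(* Moving z(yx) and x(yz) across the equality leaves two associators. *)
apply/eqP; rewrite /jordan_sum addrC -subr_eq -addrA addrC eq_sym -subr_eq eq_sym.
by apply/eqP; exact: ast_antiflexible.
Qed.

End AntiFlexibleSum.

Theorem theorem3p10 (F : fieldType) (charF0 : [pchar F] =i pred0)
    (Omega : semigroupType) (mulC : forall a b : Omega, (a * b = b * a)%g)
    (A : vectType F) (P : relPreAntiFlexible Omega A)
    (x y z : A) (a b c : Omega) :
  circ P (a * b)%g c (circ P a b x y) z - circ P a (b * c)%g x (circ P b c y z)
  = bracket P b (a * c)%g y (bracket P a c x z).
Proof.
have circl : circ P (a * b)%g c (circ P a b x y) z =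
    jordan_sum P a b c x y z + jordan_sum P b a c y x z.
  (* J(x,y,z) and J(y,x,z) mix the indices [a * b] and [b * a]; [mulC] identifies them. *)
  rewrite /circ /jordan_sum astDl astDr (mulC b a).
  by rewrite [LHS](AC (2*2) ((1*4)*(2*3))).
have circr : circ P a (b * c)%g x (circ P b c y z) =
    jordan_sum P c b a z y x + jordan_sum P b c a y z x.
  rewrite /circ /jordan_sum astDl astDr (mulC c b).
  by rewrite [LHS](AC (2*2) ((4*1)*(3*2))).
have brackr : bracket P b (a * c)%g y (bracket P a c x z) =
    jordan_sum P c a b z x y - jordan_sum P a c b x z y.
  rewrite /bracket /jordan_sum astBl astBr (mulC c a) opprB.
  by rewrite [LHS](AC (2*2) ((3*1)*(4*2))) /= -opprD.
(* J(x,y,z) cancels against J(z,y,x); the same symmetry then turns J(y,x,z) - J(y,z,x) into the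
   bracket. *)
rewrite circl circr brackr (jordan_sumC P a b c) opprD addrACA subrr add0r.
by rewrite (jordan_sumC P b a c) (jordan_sumC P b c a).
Qed.
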